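(* Let $(L,\cdot,[\;,\;])$ be a transposed Poisson algebra. Then the following identities hold for all $x,y,z,h,u,v\in L$ (juxtaposition denotes the product $\cdot$): \begin{align*} &x\cdot[y,z]+y\cdot[z,x]+z\cdot[x,y]=0,\\ &[h\cdot[x,y],z]+[h\cdot[y,z],x]+[h\cdot[z,x],y]=0,\\ &[h\cdot x,[y,z]]+[h\cdot y,[z,x]]+[h\cdot z,[x,y]]=0,\\ &[h,x]\cdot[y,z]+[h,y]\cdot[z,x]+[h,z]\cdot[x,y]=0,\\ &[x\cdot u,y\cdot v]+[x\cdot v,y\cdot u]=2\,u\cdot v\cdot[x,y],\\ &x\cdot[u,y\cdot v]+v\cdot[x\cdot y,u]+y\cdot u\cdot[v,x]=0. \end{align*}
   Context: All vector spaces are over a field $K$ of characteristic zero. Commutative associative algebras are not assumed unital. A transposed Poisson algebra is a triple $(L,\cdot,[\;,\;])$ where $L$ is a vector space, $\cdot,[\;,\;]:L\otimes L\to L$ are bilinear operations, $(L,\cdot)$ is a commutative associative algebra, $(L,[\;,\;])$ is a Lie algebra, and $2z\cdot[x,y]=[z\cdot x,y]+[x,z\cdot y]$ for all $x,y,z\in L$. *)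

(* Defs.v *)
From HB Require Import structures.
From mathcomp Require Import all_boot all_order all_algebra.

Set Implicit Arguments.
Unset Strict Implicit.
Unset Printing Implicit Defensive.

Import GRing.Theory.
Local Open Scope ring_scope.

(* The library has no Lie algebras, and its algebras are all unital, so both
   structures are stated here as predicates on bilinear operations. *)

Definition is_comm_assoc_alg (K : fieldType) (L : lmodType K)
    (mul : {bilinear L -> L -> L}) : Prop :=
  commutative mul /\ associative mul.

Definition is_lie_alg (K : fieldType) (L : lmodType K)
    (br : {bilinear L -> L -> L}) : Prop :=
  (forall x, br x x = 0) /\
  (forall x y z, br x (br y z) + br y (br z x) + br z (br x y) = 0).

Record transposedPoissonAlgebra (K : fieldType) := TransposedPoissonAlgebra {
  tp_space :> lmodType K;
  tp_mul : {bilinear tp_space -> tp_space -> tp_space};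
  tp_br : {bilinear tp_space -> tp_space -> tp_space};
  tp_mulP : is_comm_assoc_alg tp_mul;
  tp_brP : is_lie_alg tp_br;
  tp_transposed_leibniz : forall x y z : tp_space,
    (2%:R : K) *: tp_mul z (tp_br x y) =
      tp_br (tp_mul z x) y + tp_br x (tp_mul z y)
}.

Arguments tp_mul {K t}.
Arguments tp_br {K t}.

Notation "x ⋅ y" := (tp_mul x y) (at level 40, left associativity) : ring_scope.
Notation "⟦ x , y ⟧" := (tp_br x y)
  (at level 0, x at level 99, y at level 99, format "⟦ x ,  y ⟧") : ring_scope.

(* Main.v *)
Require Import Defs.
From mathcomp Require Import all_boot all_order all_algebra.
Import GRing.Theory.
Local Open Scope ring_scope.

(** Everything follows from the transposed Leibniz rule
    [⟦z ⋅ a, b⟧ + ⟦a, z ⋅ b⟧ = 2 z ⋅ ⟦a, b⟧].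

    - Summing the rule for [x ⋅ ⟦y, z⟧] cyclically, the brackets cancel
      in pairs by antisymmetry, which gives the first identity
      ([mul_br_cyclic]).
    - Let [A] and [C] be the cyclic sums of [⟦h ⋅ ⟦x, y⟧, z⟧] and of
      [⟦h ⋅ x, ⟦y, z⟧⟧].  Multiplying the Jacobi identity by [2 h] gives [A = C];
      expanding [2 h ⋅ ⟦x, y⟧] inside [2 A] and regrouping with the Jacobi
      identity gives [2 A = C].  Hence [A = C = 0] ([br_mul_br_cyclic],
      [br_mulA_br_cyclic]).
    - Applying the rule to [⟦y, z⟧ ⋅ ⟦h, x⟧] and summing cyclically
      expresses twice the fourth sum as [A] plus the bracket of [h] with the
      left-hand side of the first identity, so it vanishes ([br_mul_br]).
    - Multiplying by [u] and by [v] in turn, [4 u ⋅ v ⋅ ⟦x, y⟧] expands to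
      [2 u ⋅ v ⋅ ⟦x, y⟧] plus the two mixed terms ([br_mul_mul]).
    - The last identity combines three instances of the first one and one
      instance of the Leibniz rule ([mul_br_mul]).

    Division by [2] is used for the first identity, hence for the sixth, and for
    the fourth. *)

Lemma double_eq0 (K : fieldType) (charK : [pchar K] =i pred0)
    (V : lmodType K) (a : V) : a *+ 2 = 0 -> a = 0.
Proof.
move=> a2; apply: (@scalerI _ _ (2%:R : K)).
  by move/pcharf0P: charK => ->.
by rewrite scaler_nat a2 scaler0.
Qed.

Lemma mulC (K : fieldType) (L : transposedPoissonAlgebra K) (x y : L) :
  x ⋅ y = y ⋅ x.
Proof. by case: (tp_mulP L) => ->. Qed.

Lemma mulA (K : fieldType) (L : transposedPoissonAlgebra K) (x y z : L) :
  x ⋅ (y ⋅ z) = x ⋅ y ⋅ z.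
Proof. by case: (tp_mulP L) => _ ->. Qed.

Lemma mulCA (K : fieldType) (L : transposedPoissonAlgebra K) (x y z : L) :
  x ⋅ (y ⋅ z) = y ⋅ (x ⋅ z).
Proof. by rewrite !mulA (mulC _ _ x). Qed.

Lemma br_antisym (K : fieldType) (L : transposedPoissonAlgebra K) (x y : L) :
  ⟦x, y⟧ = - ⟦y, x⟧.
Proof.
have [br_alt _] := tp_brP L; apply/eqP; rewrite -addr_eq0; apply/eqP.
by have := br_alt (x + y); rewrite linearDl !linearDr !br_alt add0r addr0.
Qed.

Lemma jacobi (K : fieldType) (L : transposedPoissonAlgebra K) (x y z : L) :
  ⟦⟦x, y⟧, z⟧ + ⟦⟦y, z⟧, x⟧ + ⟦⟦z, x⟧, y⟧ = 0.
Proof.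
have [_ br_jac] := tp_brP L.
rewrite (br_antisym _ _ ⟦x, y⟧) (br_antisym _ _ ⟦y, z⟧).
rewrite (br_antisym _ _ ⟦z, x⟧).
by rewrite -!opprD [X in - X](ACl (2*3*1)) /= br_jac oppr0.
Qed.

Lemma jacobi_leibniz (K : fieldType) (L : transposedPoissonAlgebra K)
    (x y z : L) : ⟦⟦x, y⟧, z⟧ + ⟦⟦z, x⟧, y⟧ = ⟦x, ⟦y, z⟧⟧.
Proof.
rewrite (br_antisym _ _ x ⟦y, z⟧); apply/eqP; rewrite -addr_eq0; apply/eqP.
by rewrite addrAC jacobi.
Qed.

(** The transposed Leibniz rule, with the scalar [2] as a multiple. *)
Lemma transposed_leibniz (K : fieldType) (L : transposedPoissonAlgebra K)
    (z x y : L) : (z ⋅ ⟦x, y⟧) *+ 2 = ⟦z ⋅ x, y⟧ + ⟦x, z ⋅ y⟧.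
Proof. by rewrite -tp_transposed_leibniz scaler_nat. Qed.

Lemma mul_br_cyclic (K : fieldType) (charK : [pchar K] =i pred0)
    (L : transposedPoissonAlgebra K) (x y z : L) :
  x ⋅ ⟦y, z⟧ + y ⋅ ⟦z, x⟧ + z ⋅ ⟦x, y⟧ = 0.
Proof.
apply: (double_eq0 _ charK); rewrite !mulrnDl !transposed_leibniz.
rewrite (br_antisym _ _ y) (br_antisym _ _ z) (br_antisym _ _ x).
rewrite (mulC _ _ z x) (mulC _ _ z y) (mulC _ _ y x).
by rewrite [LHS](AC (2*2*2) ((1*4)*(5*2)*(3*6))) /= !subrr !addr0.
Qed.

Lemma br_mul_br_cyclicE (K : fieldType) (L : transposedPoissonAlgebra K)
    (x y z h : L) :
  ⟦h ⋅ ⟦x, y⟧, z⟧ + ⟦h ⋅ ⟦y, z⟧, x⟧ + ⟦h ⋅ ⟦z, x⟧, y⟧ =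
  ⟦h ⋅ x, ⟦y, z⟧⟧ + ⟦h ⋅ y, ⟦z, x⟧⟧ + ⟦h ⋅ z, ⟦x, y⟧⟧.
Proof.
have := congr1 (fun a => (h ⋅ a) *+ 2) (jacobi _ L x y z).
rewrite /= linear0r mul0rn !linearDr /= !mulrnDl !transposed_leibniz.
rewrite (br_antisym _ _ _ (h ⋅ x)) (br_antisym _ _ _ (h ⋅ y)).
rewrite (br_antisym _ _ _ (h ⋅ z)) [X in X = _ -> _](AC (2*2*2) ((1*3*5)*(4*6*2))) /=.
by rewrite -!opprD => /eqP; rewrite subr_eq0 => /eqP.
Qed.

Lemma br_mul_br_cyclic (K : fieldType) (L : transposedPoissonAlgebra K)
    (x y z h : L) :
  ⟦h ⋅ ⟦x, y⟧, z⟧ + ⟦h ⋅ ⟦y, z⟧, x⟧ + ⟦h ⋅ ⟦z, x⟧, y⟧ = 0.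
Proof.
set A := (X in X = 0).
have : A *+ 2 = A.
  rewrite {2}/A br_mul_br_cyclicE /A !mulrnDl -!(linearMnl tp_br) !transposed_leibniz.
  rewrite !linearDl /= [LHS](AC (2*2*2) ((1*6)*(3*2)*(5*4))) /=.
  by rewrite !jacobi_leibniz.
by rewrite mulr2n => /eqP; rewrite -subr_eq0 addrK => /eqP.
Qed.

Lemma br_mulA_br_cyclic (K : fieldType) (L : transposedPoissonAlgebra K)
    (x y z h : L) :
  ⟦h ⋅ x, ⟦y, z⟧⟧ + ⟦h ⋅ y, ⟦z, x⟧⟧ + ⟦h ⋅ z, ⟦x, y⟧⟧ = 0.
Proof. by rewrite -br_mul_br_cyclicE br_mul_br_cyclic. Qed.

Lemma br_mul_br (K : fieldType) (charK : [pchar K] =i pred0)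
    (L : transposedPoissonAlgebra K) (x y z h : L) :
  ⟦h, x⟧ ⋅ ⟦y, z⟧ + ⟦h, y⟧ ⋅ ⟦z, x⟧ + ⟦h, z⟧ ⋅ ⟦x, y⟧ = 0.
Proof.
apply: (double_eq0 _ charK).
rewrite (mulC _ _ ⟦h, x⟧) (mulC _ _ ⟦h, y⟧) (mulC _ _ ⟦h, z⟧).
rewrite !mulrnDl !transposed_leibniz [LHS](AC (2*2*2) ((5*1*3)*(2*4*6))) /=.
rewrite -!linearDr /= !(mulC _ _ ⟦_, _⟧) mul_br_cyclic // linear0r addr0.
exact: br_mul_br_cyclic.
Qed.

Lemma br_mul_mul (K : fieldType) (L : transposedPoissonAlgebra K)
    (x y u v : L) :
  ⟦x ⋅ u, y ⋅ v⟧ + ⟦x ⋅ v, y ⋅ u⟧ = (u ⋅ v ⋅ ⟦x, y⟧) *+ 2.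
Proof.
apply: (addrI ((u ⋅ v ⋅ ⟦x, y⟧) *+ 2)); rewrite -[RHS]mulr2n.
rewrite -mulA -[in RHS]linearMnr transposed_leibniz linearDr /= mulrnDl.
rewrite !transposed_leibniz mulA transposed_leibniz.
rewrite !mulA (mulC _ _ u x) (mulC _ _ v x) (mulC _ _ u y) (mulC _ _ v y).
by rewrite [RHS](AC (2*2) ((1*4)*(3*2))) /= addrA.
Qed.

Lemma mul_br_mul (K : fieldType) (charK : [pchar K] =i pred0)
    (L : transposedPoissonAlgebra K) (x y u v : L) :
  x ⋅ ⟦u, y ⋅ v⟧ + v ⋅ ⟦x ⋅ y, u⟧ + y ⋅ u ⋅ ⟦v, x⟧ = 0.
Proof.
have E1 := mul_br_cyclic _ charK L x u (y ⋅ v).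
have E2 := mul_br_cyclic _ charK L v (x ⋅ y) u.
have E3 := congr1 (fun a => y ⋅ a) (mul_br_cyclic _ charK L u v x).
(* The two brackets multiplied by u in E1 and E2 form a Leibniz pair. *)
have E4 : u ⋅ ⟦y ⋅ v, x⟧ + u ⋅ ⟦v, x ⋅ y⟧ = (y ⋅ u ⋅ ⟦v, x⟧) *+ 2.
  rewrite -linearDr /= (mulC _ _ x y) -transposed_leibniz linearMnr /= mulA.
  by rewrite (mulC _ _ u y).
move: E3; rewrite linear0r !linearDr /= !mulA => E3.
have : x ⋅ ⟦u, y ⋅ v⟧ + u ⋅ ⟦y ⋅ v, x⟧ + y ⋅ v ⋅ ⟦x, u⟧
     + (v ⋅ ⟦x ⋅ y, u⟧ + x ⋅ y ⋅ ⟦u, v⟧ + u ⋅ ⟦v, x ⋅ y⟧) = 0.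
  by rewrite E1 E2 addr0.
rewrite [X in X = _ -> _](AC (3*3) ((1*4)*(2*6)*(3*5))) /= E4 mulr2n.
rewrite [X in X = _ -> _](AC (2*2*2) ((1*2*3)*(4*5*6))) /= (mulC _ _ x y).
by rewrite E3 addr0.
Qed.

Theorem theorem2p5 (K : fieldType) (charK : [pchar K] =i pred0)
    (L : transposedPoissonAlgebra K) (x y z h u v : L) :
  (x ⋅ ⟦y, z⟧ + y ⋅ ⟦z, x⟧ + z ⋅ ⟦x, y⟧ = 0) /\
  (⟦h ⋅ ⟦x, y⟧, z⟧ + ⟦h ⋅ ⟦y, z⟧, x⟧ + ⟦h ⋅ ⟦z, x⟧, y⟧ = 0) /\
  (⟦h ⋅ x, ⟦y, z⟧⟧ + ⟦h ⋅ y, ⟦z, x⟧⟧ + ⟦h ⋅ z, ⟦x, y⟧⟧ = 0) /\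
  (⟦h, x⟧ ⋅ ⟦y, z⟧ + ⟦h, y⟧ ⋅ ⟦z, x⟧ + ⟦h, z⟧ ⋅ ⟦x, y⟧ = 0) /\
  (⟦x ⋅ u, y ⋅ v⟧ + ⟦x ⋅ v, y ⋅ u⟧ = (2%:R : K) *: (u ⋅ v ⋅ ⟦x, y⟧)) /\
  (x ⋅ ⟦u, y ⋅ v⟧ + v ⋅ ⟦x ⋅ y, u⟧ + y ⋅ u ⋅ ⟦v, x⟧ = 0).
Proof.
rewrite scaler_nat; repeat split.
- exact: mul_br_cyclic.
- exact: br_mul_br_cyclic.
- exact: br_mulA_br_cyclic.
- exact: br_mul_br.
- exact: br_mul_mul.
- exact: mul_br_mul.
Qed.
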